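(* Let $k$ be a field. Suppose $\mathbf{V}$ is the variety of associative $k$-algebras, the variety of Lie algebras over $k$, or, generally, any variety of $k$-algebras satisfying identities modulo which each of the monomials $(xy)z$ and $z(xy)$ is congruent to some $k$-linear combination of the eight monomials $$x(yz),\quad x(zy),\quad (yz)x,\quad (zy)x,\quad y(xz),\quad y(zx),\quad (xz)y,\quad (zx)y.$$ Then $\mathbf{V}$ is $[1,1]$-separative.
   Context: Algebras: a $k$-algebra is a $k$-vector space with a $k$-bilinear multiplication, not assumed associative, commutative or unital. A variety of $k$-algebras is the class of all $k$-algebras satisfying a fixed set of identities. Monomials: a monomial is a nonempty bracketed product of indeterminates (repetitions allowed); its length (or degree) is its length as a string of letters, ignoring parentheses. Every monomial $w$ of length $>1$ is uniquely a product $w=w'w''$ of two monomials; the submonomials of $w$ are $w$ itself and, if $\mathrm{length}(w)>1$, the submonomials of $w'$ and of $w''$. An identity says that a $k$-linear combination of monomials evaluates to zero; it is homogeneous if all the monomials in it have the same number of occurrences of each variable. Separativity: for a natural number $m$, a monomial $w$ is $m$-separating if it has a submonomial of length exactly $\mathrm{length}(w)-m$. For natural numbers $n\le N$, $w$ is $[n,N]$-separating if it is $m$-separating for some $m\in\{n,n+1,\dots,N\}$. For a natural number $d$ (with $d=0$ allowed), a variety $\mathbf{V}$ of $k$-algebras is $[1,1+d]$-separative if every monomial of degree $>1$ is congruent modulo homogeneous identities of $\mathbf{V}$ to a $k$-linear combination of $[1,1+d]$-separating monomials. *)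

(* Defs.v *)
From HB Require Import structures.
From mathcomp Require Import all_boot all_order all_algebra.
From mathcomp Require Import finmap.
From mathcomp Require Export monalg.

Set Implicit Arguments.
Unset Strict Implicit.
Unset Printing Implicit Defensive.

Import GRing.Theory.
Local Open Scope ring_scope.

(* The indeterminates are indexed by nat: countably many of them suffice to
   write any set of identities. *)
Inductive monomial : Type :=
| Var of nat
| Mul of monomial & monomial.

Declare Scope monomial_scope.
Delimit Scope monomial_scope with mon.
Bind Scope monomial_scope with monomial.
Notation "u ** v" := (Mul u v) (at level 40, left associativity)
  : monomial_scope.

Fixpoint tree_of_monomial (w : monomial) : GenTree.tree nat :=
  match w with
  | Var i => GenTree.Leaf i
  | Mul u v => GenTree.Node 0 [:: tree_of_monomial u; tree_of_monomial v]
  end.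

Fixpoint monomial_of_tree (t : GenTree.tree nat) : option monomial :=
  match t with
  | GenTree.Leaf i => Some (Var i)
  | GenTree.Node _ [:: t1; t2] =>
      match monomial_of_tree t1, monomial_of_tree t2 with
      | Some u, Some v => Some (Mul u v)
      | _, _ => None
      end
  | _ => None
  end.

Lemma tree_of_monomialK : pcancel tree_of_monomial monomial_of_tree.
Proof. by elim=> //= u -> v ->. Qed.

HB.instance Definition _ := Countable.copy monomial (pcan_type tree_of_monomialK).

Fixpoint mlength (w : monomial) : nat :=
  match w with
  | Var _ => 1
  | Mul u v => mlength u + mlength v
  end.

Fixpoint occ (i : nat) (w : monomial) : nat :=
  match w with
  | Var j => i == j
  | Mul u v => occ i u + occ i v
  end.

Fixpoint submonomials (w : monomial) : seq monomial :=
  w :: match w with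
       | Var _ => [::]
       | Mul u v => submonomials u ++ submonomials v
       end.

(* Stated with + rather than truncated subtraction. *)
Definition separating (m : nat) (w : monomial) : Prop :=
  exists2 u, u \in submonomials w & (mlength u + m = mlength w)%N.

Definition itv_separating (n N : nat) (w : monomial) : Prop :=
  exists2 m, (n <= m <= N)%N & separating m w.

(* A k-algebra: nonassociative, noncommutative and nonunital in general. *)
Record kalgebra (k : fieldType) := KAlgebra {
  kalg_sort :> lmodType k;
  amul : {bilinear kalg_sort -> kalg_sort -> kalg_sort}
}.

Fixpoint meval (k : fieldType) (A : kalgebra k) (a : nat -> A) (w : monomial)
    : A :=
  match w with
  | Var i => a i
  | Mul u v => amul A (meval a u) (meval a v)
  end.

(* {malg k[monomial]} is the vector space of formal k-linear combinations of
   monomials: msupp f is the support of f, f@_w the coefficient of w in f, and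
   << w >> the combination reduced to w. *)
Definition peval (k : fieldType) (A : kalgebra k) (a : nat -> A)
    (f : {malg k[monomial]}) : A :=
  \sum_(w <- msupp f) f@_w *: meval a w.

Definition satisfies (k : fieldType) (A : kalgebra k)
    (f : {malg k[monomial]}) : Prop :=
  forall a : nat -> A, peval a f = 0.

Definition is_variety (k : fieldType) (V : kalgebra k -> Prop) : Prop :=
  exists I : {malg k[monomial]} -> Prop,
    forall A : kalgebra k, V A <-> (forall f, I f -> satisfies A f).

Definition identity_of (k : fieldType) (V : kalgebra k -> Prop)
    (f : {malg k[monomial]}) : Prop :=
  forall A : kalgebra k, V A -> satisfies A f.

Definition homogeneous (k : fieldType) (f : {malg k[monomial]}) : Prop :=
  forall u v, u \in msupp f -> v \in msupp f -> forall i, occ i u = occ i v.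

Definition homogeneous_identity_of (k : fieldType) (V : kalgebra k -> Prop)
    (f : {malg k[monomial]}) : Prop :=
  homogeneous f /\ identity_of V f.

Definition combination_of (k : fieldType) (P : monomial -> Prop)
    (f : {malg k[monomial]}) : Prop :=
  forall w, w \in msupp f -> P w.

(* Congruence modulo the linear span of J. The (homogeneous) identities of a
   variety already include all the consequences obtained by substituting
   monomials for the variables and by multiplying by monomials. *)
Definition congruent_mod (k : fieldType) (J : {malg k[monomial]} -> Prop)
    (f g : {malg k[monomial]}) : Prop :=
  exists2 s : seq (k * {malg k[monomial]}),
    forall ch, ch \in s -> J ch.2 & f - g = \sum_(ch <- s) ch.1 *: ch.2.

(* The property called [1, 1 + d]-separative. *)
Definition separative (k : fieldType) (d : nat) (V : kalgebra k -> Prop)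
    : Prop :=
  forall w : monomial, (1 < mlength w)%N ->
    exists2 f : {malg k[monomial]},
      combination_of (itv_separating 1 (1 + d)) f
      & congruent_mod (homogeneous_identity_of V) << w >> f.

Definition associative_algebra (k : fieldType) (A : kalgebra k) : Prop :=
  associative (amul A).

(* The bracket is alternating, not merely anticommutative, so that this is the
   right notion in characteristic 2 as well. *)
Definition Lie_algebra (k : fieldType) (A : kalgebra k) : Prop :=
  (forall x, amul A x x = 0) /\
  (forall x y z, amul A x (amul A y z) + amul A y (amul A z x)
                 + amul A z (amul A x y) = 0).

Definition eight_monomials (x y z : monomial) : seq monomial :=
  [:: x ** (y ** z); x ** (z ** y); (y ** z) ** x; (z ** y) ** x;
      y ** (x ** z); y ** (z ** x); (x ** z) ** y; (z ** x) ** y]%mon.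

Definition reduces_to_eight (k : fieldType) (V : kalgebra k -> Prop) : Prop :=
  let x := Var 0 in let y := Var 1 in let z := Var 2 in
  forall w, w \in [:: (x ** y) ** z; z ** (x ** y)]%mon ->
    exists2 f : {malg k[monomial]},
      combination_of (fun u => u \in eight_monomials x y z) f
      & congruent_mod (identity_of V) << w >> f.

Lemma pevalE (k : fieldType) (A : kalgebra k) (a : nat -> A)
    (D : {fset monomial}) (f : {malg k[monomial]}) :
  (msupp f `<=` D)%fset -> peval a f = \sum_(w <- D) f@_w *: meval a w.
Proof.
move=> sfD; rewrite /peval (big_fset_incl _ sfD) // => w _ wf.
by rewrite mcoeff_outdom // scale0r.
Qed.

Lemma pevalD (k : fieldType) (A : kalgebra k) (a : nat -> A) :
  {morph @peval k A a : f g / f + g}.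
Proof.
move=> f g; pose D := (msupp f `|` msupp g)%fset.
rewrite !(@pevalE _ _ a D) ?fsubsetUl ?fsubsetUr ?msuppD_le //.
by rewrite -big_split; apply: eq_bigr => w _; rewrite mcoeffD scalerDl.
Qed.

Lemma pevalN (k : fieldType) (A : kalgebra k) (a : nat -> A) :
  {morph @peval k A a : f / - f}.
Proof.
move=> f; rewrite (@pevalE _ _ a (msupp f)) ?msuppN ?fsubset_refl //.
by rewrite -sumrN; apply: eq_bigr => w _; rewrite mcoeffN scaleNr.
Qed.

Lemma pevalU (k : fieldType) (A : kalgebra k) (a : nat -> A) (w : monomial) :
  peval a << w >> = meval a w.
Proof.
by rewrite /peval msuppU oner_eq0 big_seq_fset1 mcoeffU eqxx scale1r.
Qed.

Lemma associative_is_variety (k : fieldType) :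
  is_variety (@associative_algebra k).
Proof.
pose x := Var 0; pose y := Var 1; pose z := Var 2.
exists (fun f => f = << (x ** (y ** z))%mon >> - << ((x ** y) ** z)%mon >>) => A.
split=> [mulA _ -> a | idA u v w].
  by rewrite pevalD pevalN !pevalU /= mulA subrr.
have /(_ (nth 0 [:: u; v; w])) := idA _ erefl.
by rewrite pevalD pevalN !pevalU => /eqP; rewrite subr_eq0 => /eqP.
Qed.

Lemma Lie_is_variety (k : fieldType) : is_variety (@Lie_algebra k).
Proof.
pose x := Var 0; pose y := Var 1; pose z := Var 2.
pose J : {malg k[monomial]} :=
  << (x ** (y ** z))%mon >> + << (y ** (z ** x))%mon >> + << (z ** (x ** y))%mon >>.
exists (fun f => f = << (x ** x)%mon >> \/ f = J) => A.
split=> [[alt jac] f [] -> a | idA].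
- by rewrite pevalU /= alt.
- by rewrite !pevalD !pevalU /= jac.
split=> [u | u v w].
  by have /(_ (fun=> u)) := idA _ (or_introl erefl); rewrite pevalU.
have /(_ (nth 0 [:: u; v; w])) := idA _ (or_intror erefl).
by rewrite !pevalD !pevalU.
Qed.

(* Main.v *)
(* A product with a factor of length 1 is 1-separating.  If u = xy, then the
   hypothesis rewrites both u v and v u as combinations of products having x or
   y as a factor, so one inducts on u, with v arbitrary.  The
   identities used are multilinear in x, y, z, hence stay homogeneous when
   monomials are substituted for the variables. *)
Require Import Defs.
From mathcomp Require Import all_boot all_order all_algebra.
From mathcomp Require Import finmap zify.

Set Implicit Arguments.
Unset Strict Implicit.
Unset Printing Implicit Defensive.

Import GRing.Theory.
Local Open Scope ring_scope.

(** * Linearity of evaluation *)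

Section Evaluation.
Variables (k : fieldType) (A : kalgebra k) (a : nat -> A).

Lemma peval0 : peval a 0 = 0.
Proof. by rewrite /peval msupp0 big_seq_fset0. Qed.

Lemma pevalZ c (f : {malg k[monomial]}) : peval a (c *: f) = c *: peval a f.
Proof.
rewrite (@pevalE _ _ a (msupp f)) ?msuppZ_le // scaler_sumr.
by apply: eq_bigr => w _; rewrite mcoeffZ scalerA.
Qed.

Lemma peval_sum (I : eqType) (r : seq I) (c : I -> k)
    (F : I -> {malg k[monomial]}) :
  peval a (\sum_(i <- r) c i *: F i) = \sum_(i <- r) c i *: peval a (F i).
Proof.
elim: r => [|i r IH]; first by rewrite !big_nil peval0.
by rewrite !big_cons pevalD pevalZ IH.
Qed.

End Evaluation.

(** Identities of [V] are closed under linear combinations, so a congruence modulo their span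
    collapses to a single identity. *)
Lemma congruent_mod_identity (k : fieldType) (V : kalgebra k -> Prop) f g :
  congruent_mod (identity_of V) f g -> identity_of V (f - g).
Proof.
move=> [s Js ->] A VA a; rewrite peval_sum big_seq big1 // => ch /Js Jch.
by rewrite Jch // scaler0.
Qed.

(** * Combinations of monomials, and congruence modulo a span *)

Section Combinations.
Variables (k : fieldType) (P : monomial -> Prop).
Implicit Types (f g : {malg k[monomial]}).

Lemma combination_ofU w : P w -> @combination_of k P << w >>.
Proof. by move=> Pw u; rewrite msuppU oner_eq0 inE => /eqP ->. Qed.

Lemma combination_ofD f g :
  combination_of P f -> combination_of P g -> combination_of P (f + g).
Proof.
move=> Pf Pg w /(fsubsetP (msuppD_le _ _)).
by rewrite inE => /orP[/Pf|/Pg].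
Qed.

Lemma combination_ofZ c f : combination_of P f -> combination_of P (c *: f).
Proof. by move=> Pf w /(fsubsetP (msuppZ_le _ _)) /Pf. Qed.

Lemma combination_ofB f g :
  combination_of P f -> combination_of P g -> combination_of P (f - g).
Proof.
by move=> Pf Pg; rewrite -scaleN1r; apply/combination_ofD/combination_ofZ.
Qed.

Lemma combination_of_sum (I : eqType) (r : seq I) (c : I -> k)
    (F : I -> {malg k[monomial]}) :
  {in r, forall i, combination_of P (F i)} ->
  combination_of P (\sum_(i <- r) c i *: F i).
Proof.
move=> PF; rewrite big_seq; elim/big_ind: _ => [w|f g|i ri].
- by rewrite msupp0.
- exact: combination_ofD.
- by apply: combination_ofZ; apply: PF.
Qed.

End Combinations.

Section Spanned.
Variables (k : fieldType) (J : {malg k[monomial]} -> Prop).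
Implicit Types (f g : {malg k[monomial]}).

Lemma congruent_mod_mem f g : J (f - g) -> congruent_mod J f g.
Proof.
move=> Jfg; exists [:: (1, f - g)]; last by rewrite big_seq1 scale1r.
by move=> ch; rewrite inE => /eqP ->.
Qed.

Lemma congruent_mod_refl f : congruent_mod J f f.
Proof. by exists [::]; rewrite ?big_nil ?subrr. Qed.

Lemma congruent_modD f f' g g' :
  congruent_mod J f g -> congruent_mod J f' g' ->
  congruent_mod J (f + f') (g + g').
Proof.
move=> [s Js e] [s' Js' e']; exists (s ++ s').
  by move=> ch; rewrite mem_cat => /orP[/Js|/Js'].
by rewrite big_cat -e -e' opprD addrACA.
Qed.

Lemma congruent_modZ c f g :
  congruent_mod J f g -> congruent_mod J (c *: f) (c *: g).
Proof.
move=> [s Js e]; exists [seq (c * ch.1, ch.2) | ch <- s].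
  by move=> _ /mapP[ch /Js Jch ->].
rewrite -scalerBr e big_map scaler_sumr.
by apply: eq_bigr => ch _; rewrite scalerA.
Qed.

Lemma congruent_mod_trans g f h :
  congruent_mod J f g -> congruent_mod J g h -> congruent_mod J f h.
Proof.
move=> [s Js e] [s' Js' e']; exists (s ++ s').
  by move=> ch; rewrite mem_cat => /orP[/Js|/Js'].
by rewrite big_cat -e -e' /= addrA subrK.
Qed.

(** The condition that [separative] puts on [<< w >>], extended to every formal combination so that
    it can be passed through sums. *)
Definition spanned (P : monomial -> Prop) f : Prop :=
  exists2 g, combination_of P g & congruent_mod J f g.

Variable P : monomial -> Prop.

Lemma spannedU w : P w -> spanned P << w >>.
Proof.
move=> Pw; exists << w >>; first exact: combination_ofU.
exact: congruent_mod_refl.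
Qed.

Lemma spanned_sum (I : eqType) (r : seq I) (c : I -> k)
    (F : I -> {malg k[monomial]}) :
  {in r, forall i, spanned P (F i)} -> spanned P (\sum_(i <- r) c i *: F i).
Proof.
elim: r => [_|i r IH Fr].
  exists 0; first by move=> w; rewrite msupp0.
  by rewrite big_nil; exact: congruent_mod_refl.
have [g Pg Fg] := Fr i (mem_head _ _).
have [|h Ph Fh] := IH; first by move=> j rj; apply: Fr; rewrite inE rj orbT.
exists (c i *: g + h).
  by apply: combination_ofD => //; apply: combination_ofZ.
by rewrite big_cons; apply: congruent_modD Fh; apply: congruent_modZ.
Qed.

Lemma spanned_congruent f g :
  congruent_mod J f g -> spanned P g -> spanned P f.
Proof.
by move=> fg [h Ph gh]; exists h => //; apply: congruent_mod_trans gh.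
Qed.

End Spanned.

(** * Substitution of monomials for variables *)

Fixpoint msubst (s : nat -> monomial) (w : monomial) : monomial :=
  match w with
  | Var i => s i
  | Mul u v => Mul (msubst s u) (msubst s v)
  end.

Definition psubst (k : fieldType) (s : nat -> monomial)
    (f : {malg k[monomial]}) : {malg k[monomial]} :=
  \sum_(w <- msupp f) f@_w *: << msubst s w >>.

Lemma meval_msubst (k : fieldType) (A : kalgebra k) (a : nat -> A) s w :
  meval a (msubst s w) = meval (meval a \o s) w.
Proof. by elim: w => //= u -> v ->. Qed.

(** This is why substitution turns identities into identities: it only changes the point of
    evaluation. *)
Lemma peval_psubst (k : fieldType) (A : kalgebra k) (a : nat -> A) s f :
  peval a (psubst s f) = peval (meval a \o s) f.
Proof.
by rewrite peval_sum; apply: eq_bigr => w _; rewrite pevalU meval_msubst.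
Qed.

Lemma submonomials_refl w : w \in submonomials w.
Proof. by case: w => *; rewrite /= inE eqxx. Qed.

Lemma separating1_Mul u v :
  mlength u = 1%N -> separating 1 (u ** v)%mon /\ separating 1 (v ** u)%mon.
Proof.
by move=> u1; split; exists v; rewrite /= ?u1 1?addnC //;
  rewrite inE mem_cat submonomials_refl ?orbT.
Qed.

(** Each of the ten monomials contains x, y and z exactly once. *)
Lemma occ_msubst_eight s w i :
  let x := Var 0 in let y := Var 1 in let z := Var 2 in
  w \in [:: (x ** y) ** z, z ** (x ** y) & eight_monomials x y z]%mon ->
  occ i (msubst s w) = (occ i (s 0) + occ i (s 1) + occ i (s 2))%N.
Proof.
move=> x y z; rewrite !inE => H.
by repeat case/orP: H => [/eqP->|H]; last move/eqP: H => ->;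
  rewrite /=; lia.
Qed.

(** The hypothesis speaks of arbitrary identities; homogeneity is recovered because all monomials
    involved are multilinear in x, y, z, and it survives substitution. *)
Lemma reduces_to_eight_msubst (k : fieldType) (V : kalgebra k -> Prop) s w :
  let x := Var 0 in let y := Var 1 in let z := Var 2 in
  reduces_to_eight V -> w \in [:: (x ** y) ** z; z ** (x ** y)]%mon ->
  exists2 f : {malg k[monomial]},
    combination_of (fun u => u \in eight_monomials x y z) f
    & homogeneous_identity_of V (<< msubst s w >> - psubst s f).
Proof.
move=> x y z V8 Dw; have [f f8 /congruent_mod_identity wf] := V8 w Dw.
exists f => //; split=> [u v|A VA a]; last first.
  rewrite pevalD pevalN pevalU peval_psubst meval_msubst.
  by have := wf A VA (meval a \o s); rewrite pevalD pevalN pevalU.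
(* [P] fixes the multidegree to be that of the product of [s 0], [s 1], [s 2]. *)
pose P t := forall i,
  occ i t = (occ i (s 0) + occ i (s 1) + occ i (s 2))%N.
suff Pf : combination_of P (<< msubst s w >> - psubst s f).
  by move=> /Pf Pu /Pf Pv i; rewrite Pu Pv.
apply: combination_ofB.
  apply: combination_ofU => i; apply: occ_msubst_eight.
  by move: Dw; rewrite !inE => /orP[]->; rewrite ?orbT.
apply: combination_of_sum => t /f8 t8; apply: combination_ofU => i.
by apply: occ_msubst_eight; rewrite 2!inE t8 !orbT.
Qed.

(** * Induction on one factor of a product *)

Lemma reduces_to_eight_separative (k : fieldType) (V : kalgebra k -> Prop) :
  reduces_to_eight V -> separative 0 V.
Proof.
move=> V8; pose red w :=
  spanned (homogeneous_identity_of V) (itv_separating 1 (1 + 0)) << w >>.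
(* Both orders are proved together, since the eight monomials carry x or y on either side. *)
suff redM u v : red (u ** v)%mon /\ red (v ** u)%mon.
  by case=> // u v _; apply: (redM u v).1.
elim: u v => [i|x IHx y IHy] v.
  have [sl sr] := separating1_Mul v (erefl : mlength (Var i) = 1%N).
  by split; apply: spannedU; exists 1%N.
(* The default value of [nth] sends [Var 2] to [v]. *)
pose s := nth v [:: x; y].
have red_s w : w \in [:: (Var 0 ** Var 1) ** Var 2;
                         Var 2 ** (Var 0 ** Var 1)]%mon -> red (msubst s w).
  case/(reduces_to_eight_msubst s V8) => f f8 /congruent_mod_mem wf.
  apply: spanned_congruent wf _; apply: spanned_sum => t /f8.
  rewrite !inE => t8.
  (* The first four monomials have x as a factor, the last four y; [.1] or [.2] is chosen by whether
     it stands on the left or on the right. *)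
  case/orP: t8 => [/eqP->|t8]; first exact: (IHx _).1.
  case/orP: t8 => [/eqP->|t8]; first exact: (IHx _).1.
  case/orP: t8 => [/eqP->|t8]; first exact: (IHx _).2.
  case/orP: t8 => [/eqP->|t8]; first exact: (IHx _).2.
  case/orP: t8 => [/eqP->|t8]; first exact: (IHy _).1.
  case/orP: t8 => [/eqP->|t8]; first exact: (IHy _).1.
  case/orP: t8 => [/eqP->|t8]; first exact: (IHy _).2.
  by move/eqP: t8 => ->; exact: (IHy _).2.
by split; [apply: (red_s (Var 0 ** Var 1 ** Var 2)%mon)
         | apply: (red_s (Var 2 ** (Var 0 ** Var 1))%mon)];
  rewrite !inE eqxx ?orbT.
Qed.

(** * Associative and Lie algebras *)

Lemma associative_reduces_to_eight (k : fieldType) (V : kalgebra k -> Prop) :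
  (forall A, V A -> associative_algebra A) -> reduces_to_eight V.
Proof.
move=> VA x y z w; rewrite !inE => /orP[]/eqP->.
  (* Reassociating gives (xy)z = x(yz) and, below, z(xy) = (zx)y. *)
  exists << (x ** (y ** z))%mon >>; first exact: combination_ofU.
  apply: congruent_mod_mem => A /VA mulA a.
  by rewrite pevalD pevalN !pevalU /= mulA subrr.
exists << ((z ** x) ** y)%mon >>; first exact: combination_ofU.
apply: congruent_mod_mem => A /VA mulA a.
by rewrite pevalD pevalN !pevalU /= mulA subrr.
Qed.

(** Polarization: expand the square of [u + v], which vanishes. *)
Lemma Lie_anticommutative (k : fieldType) (A : kalgebra k) (u v : A) :
  Lie_algebra A -> amul A u v = - amul A v u.
Proof.
move=> [alt _]; have := alt (u + v).
rewrite linearDl !linearDr /= !alt add0r addr0.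
by move/eqP; rewrite addr_eq0 => /eqP.
Qed.

(** The Jacobi identity gives z(xy) = -(x(yz) + y(zx)), and anticommutativity then gives (xy)z =
    x(yz) + y(zx). *)
Lemma Lie_reduces_to_eight (k : fieldType) (V : kalgebra k -> Prop) :
  (forall A, V A -> Lie_algebra A) -> reduces_to_eight V.
Proof.
move=> VL x y z w.
pose f : {malg k[monomial]} :=
  << (x ** (y ** z))%mon >> + << (y ** (z ** x))%mon >>.
have f8 : combination_of (fun u => u \in eight_monomials x y z) f.
  by apply: combination_ofD; apply: combination_ofU.
rewrite !inE => /orP[]/eqP->.
  exists f => //; apply: congruent_mod_mem => A /VL LA a.
  rewrite pevalD pevalN pevalD !pevalU /= (Lie_anticommutative _ (a 2) LA).
  by rewrite -opprD addrC LA.2 oppr0.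
exists (- f).
  by rewrite -scaleN1r; apply: combination_ofZ.
apply: congruent_mod_mem => A /VL LA a.
by rewrite opprK addrC !pevalD !pevalU LA.2.
Qed.

Theorem lemma13 (k : fieldType) (V : kalgebra k -> Prop)
    (hV : is_variety V)
    (hV' : (forall A : kalgebra k, V A <-> associative_algebra A)
           \/ (forall A : kalgebra k, V A <-> Lie_algebra A)
           \/ reduces_to_eight V) :
  separative 0 V.
Proof.
apply: reduces_to_eight_separative; case: hV' => [VA|[VL|//]].
  by apply: associative_reduces_to_eight => A /VA.
by apply: Lie_reduces_to_eight => A /VL.
Qed.
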